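(* Let $A$ be a real finite-dimensional affine space. The nullspace of the gradient linear map $\nabla:\mathrm{Quad}(A)\to\mathrm{Aff}(A,\vec A^* )$ is the subspace $\mathbb R\subset\mathrm{Quad}(A)$ of constant functions, and its image is the subspace $\mathrm{Aff}^S(A,\vec A^* )$ of affine covector fields $\omega:A\to\vec A^*$ with self-adjoint principal component.
   Context: All spaces are real and finite-dimensional. $A$ is an affine space with director vector space $\vec A$; $\mathrm{Aff}(A)$ is the space of affine functions $A\to\mathbb R$; $\vec A^*=\mathrm{Aff}(A)/\mathbb R$ is the dual of $\vec A$ (the class of $f$ modulo constants being its linear part $\mathrm df$). $\mathrm{Aff}(A,\vec A^* )$ is the vector space of affine maps $A\to\vec A^*$ (affine covector fields). A function $\delta:A\to\mathbb R$ is quadratic if $\delta(\alpha P+\beta Q)=\alpha(\alpha-\beta)\delta(P)+\beta(\beta-\alpha)\delta(Q)+4\alpha\beta\,\delta(\frac{P+Q}2)$ for all $P,Q\in A$ and reals $\alpha+\beta=1$; $\mathrm{Quad}(A)$ is the vector space of quadratic functions. For $\delta\in\mathrm{Quad}(A)$ and $P\in A$, the homogenization of $\delta$ at $P$ is $\delta^h_P(Q)=\frac12(\delta(Q)+\delta(2P-Q))-\delta(P)$; the function $\delta-\delta^h_P$ is affine, and the gradient covector of $\delta$ at $P$ is $\nabla_P\delta=\mathrm d(\delta-\delta^h_P)\in\vec A^*$. The gradient covector field $\nabla\delta: P\mapsto\nabla_P\delta$ is an affine map $A\to\vec A^*$. The principal component of $\omega\in\mathrm{Aff}(A,\vec A^*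 )$ is the bilinear form $\vec\omega:\vec A\to\vec A^*$, $\langle\vec x,\vec\omega(\vec y)\rangle=\langle\omega_{P+\vec y},\vec x\rangle-\langle\omega_P,\vec x\rangle$ (independent of $P\in A$). It is self-adjoint when $\langle\vec x,\vec\omega(\vec y)\rangle=\langle\vec y,\vec\omega(\vec x)\rangle$ for all $\vec x,\vec y\in\vec A$. *)

(* Defs.v *)
From HB Require Import structures.
From mathcomp Require Import all_boot all_order all_algebra.
From mathcomp Require Import boolp classical_sets functions reals.
From mathcomp Require Import ring lra.

Set Implicit Arguments.
Unset Strict Implicit.
Unset Printing Implicit Defensive.

Import Order.TTheory GRing.Theory Num.Theory.

Local Open Scope ring_scope.

(* [translate P x] is P + x, and [vec P Q] is the vector Q - P. These laws say
   that the additive group of V acts freely and transitively on A. *)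
HB.mixin Record isAffineSpace (R : realType) (V : vectType R) (A : Type) := {
  translate : A -> V -> A;
  vec : A -> A -> V;
  affine_inhabited : inhabited A;
  translateD : forall P x y, translate (translate P x) y = translate P (x + y);
  vecK : forall P Q, translate P (vec P Q) = Q;
  translateK : forall P x, vec P (translate P x) = x
}.

#[short(type="affineSpaceType")]
HB.structure Definition AffineSpace (R : realType) (V : vectType R) :=
  {A of isAffineSpace R V A}.

Section Points.
Variables (R : realType) (V : vectType R) (A : affineSpaceType V).
Implicit Types (P Q : A) (x y : V).

Lemma affine_nonempty : exists _ : A, True.
Proof. by case: (@affine_inhabited R V A) => P; exists P. Qed.

Definition affine_origin : A := projT1 (cid affine_nonempty).

Lemma translate0 P : translate P 0 = P.
Proof. by rewrite -{1}(vecK P P) translateD addr0 vecK. Qed.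

(* The barycentric combination aP + bQ; only meaningful when a + b = 1, in
   which case it is P + b(Q - P). *)
Definition bary (a b : R) P Q : A := translate P (b *: vec P Q).

Lemma bary_translate a b P x y : a + b = 1 ->
  bary a b (translate P x) (translate P y) = translate P (a *: x + b *: y).
Proof.
move=> ab1; rewrite /bary translateD.
have -> : vec (translate P x) (translate P y) = y - x.
  by rewrite -[y in LHS](addNKr x) -translateD translateK addrC.
congr translate; have -> : a = 1 - b by rewrite -ab1 addrK.
by rewrite scalerBr scalerBl scale1r addrCA addrC.
Qed.

End Points.

Notation dual V := 'Hom(V, _^o) (only parsing).

Section AffineMaps.
Variables (R : realType) (V : vectType R) (A : affineSpaceType V).
Variable W : vectType R.

Definition is_affine (f : A -> W) : Prop :=
  forall (a b : R) (P Q : A), a + b = 1 ->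
    f (bary a b P Q) = a *: f P + b *: f Q.

Definition affine_pred : {pred A -> W} := fun f => `[< is_affine f >].

Lemma affine_submod_closed : submod_closed affine_pred.
Proof.
split; first by apply/asboolP => a b P Q _; rewrite /= !scaler0 addr0.
move=> k f g /asboolP fA /asboolP gA; apply/asboolP => a b P Q ab1.
rewrite [LHS]/(k *: f _ + g _) fA// gA//.
rewrite -[(k *: f + g) P]/(k *: f P + g P) -[(k *: f + g) Q]/(k *: f Q + g Q).
by rewrite !scalerDr !scalerA ![_ * k]mulrC addrACA.
Qed.

HB.instance Definition _ :=
  GRing.isSubmodClosed.Build R (A -> W) affine_pred affine_submod_closed.

Record affineMap := AffineMap {
  affine_fun :> A -> W;
  _ : affine_fun \in affine_pred
}.

HB.instance Definition _ := [isSub for affine_fun].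
HB.instance Definition _ := [Choice of affineMap by <:].
HB.instance Definition _ := [SubChoice_isSubLmodule of affineMap by <:].

Lemma affineMapP (f : affineMap) (a b : R) (P Q : A) : a + b = 1 ->
  f (bary a b P Q) = a *: f P + b *: f Q.
Proof. by case: f => f fA; move/asboolP: (fA); apply. Qed.

Definition affine_of (f : A -> W) (fA : is_affine f) : affineMap :=
  AffineMap (introT (asboolP _) fA).

(* linfun needs no proof of linearity, but it is meaningful only on linear
   functions: see [linear_partE], which also shows that the choice of origin
   is irrelevant. *)
Definition linear_part (f : affineMap) : 'Hom(V, W) :=
  let O := affine_origin A in linfun (fun x => f (translate O x) - f O).

Lemma affine_translateD (f : affineMap) P x y :
  f (translate P (x + y)) = f (translate P x) + f (translate P y) - f P.
Proof.
have half2 : 2^-1 + 2^-1 = 1 :> R by lra.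
have n2 : 2^-1 != 0 :> R by apply/eqP; lra.
apply/eqP; rewrite eq_sym subr_eq; apply/eqP.
apply: (scalerI n2); rewrite !scalerDr.
have := affineMapP f (translate P x) (translate P y) half2.
have := affineMapP f (translate P (x + y)) (translate P 0) half2.
by rewrite !bary_translate// scaler0 addr0 translate0 => <-; rewrite scalerDr => <-.
Qed.

Lemma affine_translateZ (f : affineMap) P a x :
  f (translate P (a *: x)) - f P = a *: (f (translate P x) - f P).
Proof.
have a1 : a + (1 - a) = 1 by rewrite subrKC.
have := affineMapP f (translate P x) (translate P 0) a1.
rewrite bary_translate// scaler0 addr0 translate0 => ->.
by rewrite scalerBl scalerBr scale1r -addrA addrAC subrr add0r.
Qed.

Lemma linear_partE (f : affineMap) P x :
  linear_part f x = f (translate P x) - f P.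
Proof.
pose O := affine_origin A; pose g x := f (translate O x) - f O.
have g_lin : linear g.
  move=> a u v; rewrite /g -affine_translateZ affine_translateD.
  by rewrite -addrA addrACA.
pose G := GRing.isLinear.Build R V W *:%R g g_lin.
pose gL : {linear V -> W} := HB.pack g G.
rewrite [LHS](lfunE gL x) /= /g -(vecK O P) translateD affine_translateD.
by rewrite [RHS]addrAC [_ + f (translate O x)]addrC addrK.
Qed.

End AffineMaps.

(* [linear_part] identifies the quotient of the affine functions by the
   constants with the dual of V. *)
Lemma linear_part_dualP (R : realType) (V : vectType R)
    (A : affineSpaceType V) :
  (forall phi : dual V, exists f : affineMap A R^o, linear_part f = phi) /\
  (forall f g : affineMap A R^o, linear_part f = linear_part g <->
     exists c : R, forall P, f P = g P + c).
Proof.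
split=> [phi|f g].
  pose f (P : A) := phi (vec (affine_origin A) P).
  have fA : is_affine f.
    move=> a b P Q ab1; set O := affine_origin A.
    rewrite -(vecK O P) -(vecK O Q) bary_translate// /f !translateK.
    by rewrite linearD !linearZ.
  exists (affine_of fA); apply/lfunP => x.
  rewrite (linear_partE _ (affine_origin A)) /= /f translateK.
  by rewrite -{2}(translate0 (affine_origin A)) translateK linear0 subr0.
split=> [fg|[c fg]]; last first.
  apply/lfunP => x; rewrite !(linear_partE _ (affine_origin A)) !fg.
  by rewrite opprD addrACA subrr addr0.
pose O := affine_origin A; exists (f O - g O) => P.
have /lfunP/(_ (vec O P)) := fg; rewrite !(linear_partE _ O) !vecK => /eqP.
by rewrite subr_eq => /eqP ->; rewrite addrAC -addrA.
Qed.

Section QuadraticFunctions.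
Variables (R : realType) (V : vectType R) (A : affineSpaceType V).

Definition is_quadratic (d : A -> R^o) : Prop :=
  forall (a b : R) (P Q : A), a + b = 1 ->
    d (bary a b P Q) = a * (a - b) * d P + b * (b - a) * d Q
                       + 4 * a * b * d (bary 2^-1 2^-1 P Q).

Definition quadratic_pred : {pred A -> R^o} := fun d => `[< is_quadratic d >].

Lemma quadratic_submod_closed : submod_closed quadratic_pred.
Proof.
split.
  by apply/asboolP => a b P Q _; rewrite -[LHS]/0 -[0 P]/0 !mulr0 !addr0.
move=> k f g /asboolP fq /asboolP gq; apply/asboolP => a b P Q ab1.
have E T : (k *: f + g) T = k * f T + g T by [].
by rewrite !E fq// gq//; ring.
Qed.

HB.instance Definition _ :=
  GRing.isSubmodClosed.Build R (A -> R^o) quadratic_pred quadratic_submod_closed.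

Record quadraticFun := QuadraticFun {
  quadratic_fun :> A -> R^o;
  _ : quadratic_fun \in quadratic_pred
}.

HB.instance Definition _ := [isSub for quadratic_fun].
HB.instance Definition _ := [Choice of quadraticFun by <:].
HB.instance Definition _ := [SubChoice_isSubLmodule of quadraticFun by <:].

Lemma quadraticFunP (d : quadraticFun) : is_quadratic d.
Proof. by case: d => d dq; move/asboolP: (dq). Qed.

(* [bary 2 (- 1) P Q] is the reflection 2P - Q of Q through P. *)
Definition homogenization (d : quadraticFun) (P : A) : A -> R^o :=
  fun Q => 2^-1 * (d Q + d (bary 2 (- 1) P Q)) - d P.

Definition odd_part (d : quadraticFun) (P : A) (x : V) : R :=
  2^-1 * (d (translate P x) - d (translate P (- x))).

Lemma odd_part_quadratic d P a b x y : a + b = 1 ->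
  odd_part d P (a *: x + b *: y) =
    a * (a - b) * odd_part d P x + b * (b - a) * odd_part d P y
    + 4 * a * b * odd_part d P (2^-1 *: x + 2^-1 *: y).
Proof.
move=> ab1; have half2 : 2^-1 + 2^-1 = 1 :> R by lra.
rewrite /odd_part !opprD -!scalerN -!bary_translate//.
by rewrite !(quadraticFunP d _ _ ab1); ring.
Qed.

Lemma odd_partN d P x : odd_part d P (- x) = - odd_part d P x.
Proof. by rewrite /odd_part opprK; ring. Qed.

Lemma odd_part0 d P : odd_part d P 0 = 0.
Proof. by rewrite /odd_part oppr0 subrr mulr0. Qed.

Lemma odd_partZ d P t x : odd_part d P (t *: x) = t * odd_part d P x.
Proof.
have ab1 : (1 + t) / 2 + (1 - t) / 2 = 1 by lra.
have := odd_part_quadratic d P x (- x) ab1.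
rewrite odd_partN !scalerN -scalerBl -scalerBl subrr scale0r odd_part0.
have -> : (1 + t) / 2 - (1 - t) / 2 = t by field.
by move=> ->; field.
Qed.

Lemma odd_partD d P x y :
  odd_part d P (x + y) = odd_part d P x + odd_part d P y.
Proof.
(* On the line t |-> x + t y the odd part is quadratic, and homogeneity gives
   its values at t = 1, 2, 3 up to the defect of additivity at (x, y). *)
have comb (s t : R) : s + t != 0 ->
    odd_part d P (s *: x + t *: y) = s * odd_part d P x + t * odd_part d P y
    + 2 * s * t / (s + t) *
      (odd_part d P (x + y) - odd_part d P x - odd_part d P y).
  move=> st; have ab1 : s / (s + t) + t / (s + t) = 1 by field.
  have -> : s *: x + t *: y =
      (s + t) *: ((s / (s + t)) *: x + (t / (s + t)) *: y).
    by rewrite scalerDr !scalerA !(mulrC (s + t)) !divfK.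
  rewrite odd_partZ odd_part_quadratic// -scalerDr odd_partZ.
  by field.
have ab1 : - 2^-1 + 3 / 2 = 1 :> R by lra.
have := odd_part_quadratic d P x (x + 2 *: y) ab1.
have -> : - 2^-1 *: x + (3 / 2) *: (x + 2 *: y) = 1 *: x + 3 *: y.
  by rewrite scalerDr addrA -scalerDl scalerA; congr (_ *: _ + _ *: _); lra.
have -> : 2^-1 *: x + 2^-1 *: (x + 2 *: y) = 1 *: x + 1 *: y.
  by rewrite scalerDr addrA -scalerDl scalerA; congr (_ *: _ + _ *: _); lra.
have -> : x + 2 *: y = 1 *: x + 2 *: y by rewrite scale1r.
have [e2 e3 e4] : [/\ 1 + 1 = 2 :> R, 1 + 2 = 3 :> R & 1 + 3 = 4 :> R].
  by split; lra.
by rewrite !comb ?e2 ?e3 ?e4 ?pnatr_eq0//; lra.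
Qed.

Lemma sub_homogenizationE (d : quadraticFun) P x :
  d (translate P x) - homogenization d P (translate P x) =
  odd_part d P x + d P.
Proof.
rewrite /homogenization /odd_part.
have -> : bary 2 (- 1) P (translate P x) = translate P (- x).
  by rewrite /bary translateK scaleN1r.
by lra.
Qed.

Lemma sub_homogenization_affine (d : quadraticFun) P :
  is_affine ((d : A -> R^o) - homogenization d P).
Proof.
move=> a b S T ab1.
have E Q : ((d : A -> R^o) - homogenization d P) Q = d Q - homogenization d P Q.
  by [].
rewrite !E -(vecK P S) -(vecK P T) bary_translate// !sub_homogenizationE.
rewrite odd_partD !odd_partZ.
have Z (k c : R) : k *: (c : R^o) = k * c by [].
rewrite !Z; have -> : a = 1 - b by rewrite -ab1 addrK.
by ring.
Qed.

Definition gradient_covector (d : quadraticFun) (P : A) : dual V :=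
  linear_part (affine_of (sub_homogenization_affine d P)).

Lemma gradient_covectorE d P x :
  gradient_covector d P x =
  2^-1 * (d (translate P x) - d (translate P (- x))).
Proof.
rewrite /gradient_covector (linear_partE _ P) /=.
rewrite -[X in _ - X = _](congr1 _ (translate0 P)).
rewrite -[LHS]/((d (translate P x) - homogenization d P (translate P x)) -
  (d (translate P 0) - homogenization d P (translate P 0))).
by rewrite !sub_homogenizationE odd_part0 /odd_part; ring.
Qed.

Lemma odd_part_midpoint d M x y :
  odd_part d (translate M y) x + odd_part d (translate M (- y)) x =
  2 * odd_part d M x.
Proof.
have -> : 2 * odd_part d M x = odd_part d M (x + y) + odd_part d M (x - y).
  by rewrite !odd_partD odd_partN; ring.
rewrite /odd_part !translateD !opprD opprK ![x + _]addrC ![- x + _]addrC.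
by ring.
Qed.

Lemma odd_part_bary d a b P Q x : a + b = 1 ->
  odd_part d (bary a b P Q) x = a * odd_part d P x + b * odd_part d Q x.
Proof.
move=> ab1; rewrite /bary -{2}(vecK P Q); move: (vec P Q) => v.
have half2 : 2^-1 + 2^-1 = 1 :> R by lra.
have line (s t : R) z : s + t = 1 -> translate (translate P (t *: v)) z =
    bary s t (translate P z) (translate (translate P v) z).
  move=> st; rewrite !translateD bary_translate// scalerDr addrCA -scalerDl.
  by rewrite st scale1r.
have mid := odd_part_midpoint d (translate P (2^-1 *: v)) x (2^-1 *: v).
have E1 : translate (translate P (2^-1 *: v)) (2^-1 *: v) = translate P v.
  by rewrite translateD -scalerDl half2 scale1r.
have E2 : translate (translate P (2^-1 *: v)) (- (2^-1 *: v)) = P.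
  by rewrite translateD subrr translate0.
move: mid; rewrite E1 E2 /odd_part !(line _ _ _ ab1) !(line _ _ _ half2).
rewrite !(quadraticFunP d _ _ ab1) => mid.
have -> : a = 1 - b by rewrite -ab1 addrK.
by nra.
Qed.

Lemma gradient_covector_affine d : is_affine (gradient_covector d).
Proof.
move=> a b P Q ab1; apply/lfunP => x.
rewrite add_lfunE !scale_lfunE !gradient_covectorE.
exact: odd_part_bary.
Qed.

Definition gradient (d : quadraticFun) : affineMap A (dual V) :=
  affine_of (gradient_covector_affine d).

Lemma gradient_linear : linear gradient.
Proof.
move=> k d e; apply/val_inj/funext => P.
rewrite [RHS](_ : _ = k *: gradient_covector d P + gradient_covector e P)//.
apply/lfunP => x; rewrite add_lfunE scale_lfunE !gradient_covectorE.
have E T : (k *: d + e) T = k * d T + e T by [].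
have Z (c r : R) : c *: (r : R^o) = c * r by [].
by rewrite !E Z; ring.
Qed.

HB.instance Definition _ :=
  GRing.isLinear.Build R quadraticFun (affineMap A (dual V)) *:%R gradient
    gradient_linear.

Definition gradient_map : {linear quadraticFun -> affineMap A (dual V)} :=
  gradient.

End QuadraticFunctions.

Section SelfAdjoint.
Variables (R : realType) (V : vectType R) (A : affineSpaceType V).

Definition principal_component (w : affineMap A (dual V)) :
  'Hom(V, dual V) := linear_part w.

Lemma principal_componentE w P x y :
  principal_component w y x = w (translate P y) x - w P x.
Proof. by rewrite /principal_component (linear_partE w P) add_lfunE opp_lfunE. Qed.

Definition self_adjoint (phi : 'Hom(V, dual V)) : Prop :=
  forall x y : V, phi y x = phi x y.

End SelfAdjoint.

(* Main.v *)
Require Import Defs.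
From HB Require Import structures.
From mathcomp Require Import all_boot all_order all_algebra.
From mathcomp Require Import boolp classical_sets functions reals.
From mathcomp Require Import ring lra.

(** The central fact is that the midpoint rule integrates the gradient of a
    quadratic function exactly: d(P + x) - d(P) is the gradient covector at
    P + x/2, evaluated on x ([gradient_midpoint_rule]). A quadratic function
    with zero gradient is therefore constant.

    The principal component of the gradient is a second difference of d, and
    its symmetry reduces to the additivity of the gradient covector at a single
    point ([gradient_self_adjoint]).

    Conversely, the midpoint rule dictates what an antiderivative of an affine
    covector field w must be: from an origin O it takes the value
    w_O(x) + phi(x, x)/2 at O + x, with phi the principal component of w. This
    function is quadratic for every w. Its gradient at O + p sends x to w_O(x)
    plus the average of phi(p, x) and phi(x, p), which is w_(O + p)(x) as soon
    as phi is symmetric ([gradient_antiderivative]). *)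

Import Order.TTheory GRing.Theory Num.Theory.
Local Open Scope classical_set_scope.
Local Open Scope ring_scope.

Section Gradient.
Context {R : realType} {V : vectType R} {A : affineSpaceType V}.
Implicit Types (d : quadraticFun A) (w : affineMap A (dual V)) (P O : A).

(** The points P and P + x are symmetric about P + x/2, so the difference of
    the values of d is twice its odd part there. *)
Lemma gradient_midpoint_rule d P (x : V) :
  d (translate P x) - d P = gradient d (translate P (2^-1 *: x)) x.
Proof.
have half2 : 2^-1 + 2^-1 = 1 :> R by lra.
set h := 2^-1 *: x; have -> : x = h + h by rewrite -scalerDl half2 scale1r.
rewrite linearD /= !gradient_covectorE !translateD subrr translate0.
by field.
Qed.

Lemma gradient_eq0P d : gradient d = 0 <-> exists c : R, forall P, d P = c.
Proof.
split=> [d0 | [c dc]].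
  exists (d (affine_origin A)) => P; apply/eqP; rewrite -subr_eq0.
  rewrite -[X in d X - _](vecK (affine_origin A)) gradient_midpoint_rule d0.
  by rewrite -[(0 : affineMap A (dual V)) _]/(0 : dual V) lfunE.
apply/val_inj/funext => P; apply/lfunP => x.
rewrite -[(\val 0) P]/(0 : dual V) [RHS]lfunE /=.
by rewrite gradient_covectorE !dc subrr mulr0.
Qed.

(** Both sides contain d(P + x + y); what remains of the symmetry is the
    identity stating that the gradient covector at P sends y - x to the
    difference of the images of y and x. *)
Lemma gradient_self_adjoint d : self_adjoint (principal_component (gradient d)).
Proof.
move=> x y; rewrite !(principal_componentE _ (affine_origin A)) /=.
have := linearB (gradient_covector d (affine_origin A)) y x.
rewrite /= !gradient_covectorE !translateD opprB [y + x]addrC.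
by lra.
Qed.

Definition antiderivative w O : A -> R^o := fun P =>
  let x := vec O P in w O x + 2^-1 * principal_component w x x.

(** The function is the sum of a linear and a quadratic form in the vector from
    O, and each of these satisfies the quadratic identity: for the linear form,
    a (a - b) + 2 a b = a; for the quadratic form, a (a - b) + a b = a ^ 2. *)
Lemma antiderivative_quadratic w O : is_quadratic (antiderivative w O).
Proof.
move=> a b P Q ab1; have half2 : 2^-1 + 2^-1 = 1 :> R by lra.
rewrite -(vecK O P) -(vecK O Q) !bary_translate// /antiderivative !translateK.
move: (vec O P) (vec O Q) => x y.
have Z (c : R) (r : R^o) : c *: r = c * r by [].
rewrite !linearD !linearZ /= !add_lfunE !scale_lfunE !linearD !linearZ /= !Z.
by have -> : a = 1 - b by [rewrite -ab1 addrK]; field.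
Qed.

Lemma antiderivative_in_quadratic_pred w O :
  antiderivative w O \in @quadratic_pred R V A.
Proof. exact/asboolP/antiderivative_quadratic. Qed.

Lemma gradient_antiderivative w O : self_adjoint (principal_component w) ->
  gradient (QuadraticFun (antiderivative_in_quadratic_pred w O)) = w.
Proof.
move=> w_sym; apply/val_inj/funext => P; apply/lfunP => x.
rewrite /= gradient_covectorE /= -(vecK O P) !translateD /antiderivative.
rewrite !translateK; move: (vec O P) => p.
have := principal_componentE w O x p; have := w_sym x p.
rewrite !linearD !linearN /= !add_lfunE !opp_lfunE !linearD !linearN /=.
by lra.
Qed.

End Gradient.

Theorem proposition3p7 (R : realType) (V : vectType R) (A : affineSpaceType V) :
  [set d : quadraticFun A | gradient_map A d = 0] =
    [set d : quadraticFun A | exists c : R, forall P : A, d P = c] /\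
  range (gradient_map A) =
    [set w : affineMap A (dual V) | self_adjoint (principal_component w)].
Proof.
split; first by apply/seteqP; split=> d /= /gradient_eq0P.
apply/seteqP; split=> [w [d _ <-] | w w_sym] /=.
  exact: gradient_self_adjoint.
eexists; first by [].
exact: (gradient_antiderivative w (affine_origin A) w_sym).
Qed.
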